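(* Let $G$ be a finite group and let $b$ be a block of $kG$. Let $\{S_i\}_{1\le i\le l(b)}$ be a set of representatives of the isomorphism classes of simple $kGb$-modules, and let $\{Q_i\}_{1\le i\le l(b)}$ be the lower defect groups of $b$ associated with $p$-regular classes. Then there exists a permutation $\sigma$ of $\{1,2,\dots,l(b)\}$ such that \[Q_i \leq_G \mathrm{vx}(S_{\sigma(i)})\] for all $i$. In particular, \[\prod_{i=1}^{l(b)}|Q_i| \leq \prod_{i=1}^{l(b)}|\mathrm{vx}(S_i)|.\]
   Context: $k$ is an algebraically closed field of characteristic $p>0$, the residue field of a complete discrete valuation ring $\mathcal{O}$ of characteristic $0$. Modules are finitely generated right modules. A block of $kG$ is a primitive idempotent of the center $ZkG$ of $kG$. For an indecomposable $kG$-module $M$, $\mathrm{vx}(M)$ denotes a vertex of $M$. For subgroups $A,B$ of $G$, $A\leq_G B$ means that some $G$-conjugate of $A$ is contained in $B$. Lower defect groups associated with $p$-regular classes: let $G_{p'}$ be the set of $p$-regular elements of $G$ (elements of order prime to $p$), $kG_{p'}$ the $k$-span of $G_{p'}$ in $kG$, $\mathrm{Cl}(G_{p'})$ the set of $p$-regular conjugacy classes, $ZkG_{p'}=ZkG\cap kG_{p'}$, and $\hat C=\sum_{x\in C}x$ for a class $C$. There is a disjoint decomposition $\mathrm{Cl}(G_{p'})=\bigcup_b \mathrm{Cl}_{p'}(b)$, with $b$ ranging over the blocks of $kG$, such that $\{\hat C b \mid C\in \mathrm{Cl}_{p'}(b)\}$ is a basis of $ZkG_{p'}b$ for every block $b$;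 fix one. The number $l(b)=|\mathrm{Cl}_{p'}(b)|$ equals the number of isomorphism classes of simple $kGb$-modules. Write $\mathrm{Cl}_{p'}(b)=\{C_i\}_{1\le i\le l(b)}$ and let $Q_i$ be a defect group of $C_i$, i.e. a Sylow $p$-subgroup of $C_G(x_i)$ for some $x_i\in C_i$. The $Q_i$ are the lower defect groups of $b$ associated with $p$-regular classes. (It is known that the multiplicity with which each $G$-conjugacy class of $p$-subgroups occurs among the $Q_i$ does not depend on the choice of decomposition.) *)

(* Defs.v *)
From HB Require Import structures.
From mathcomp Require Import all_boot all_order all_algebra all_fingroup.
From mathcomp Require Import all_solvable all_field all_character.

Set Implicit Arguments.
Unset Strict Implicit.
Unset Printing Implicit Defensive.

Import GRing.Theory.
Local Open Scope ring_scope.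

(** The group algebra kG is [group_ring k G], i.e. the span of the matrices
    [regular_repr k G x]; its elements are square matrices of size #|G|.  A
    finitely generated right kG-module is an [mx_representation k G n], acting
    on row vectors from the right, and an element A of kG acts on it as
    [gring_op rG A]. *)

Definition in_center (k : fieldType) (gT : finGroupType) (G : {group gT})
    (A : 'M[k]_#|G|) : Prop :=
  (A \in 'Z(group_ring k G))%MS.

Definition is_block (k : fieldType) (gT : finGroupType) (G : {group gT})
    (b : 'M[k]_#|G|) : Prop :=
  [/\ in_center b, b *m b = b, b != 0
    & forall e f : 'M[k]_#|G|,
        in_center e -> in_center f -> e *m e = e -> f *m f = f ->
        e *m f = 0 -> e + f = b -> e = 0 \/ f = 0].

Definition in_block (k : fieldType) (gT : finGroupType) (G : {group gT})
    (b : 'M[k]_#|G|) (n : nat) (rM : mx_representation k G n) : Prop :=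
  gring_op rM b = 1%:M.

Definition simple_reps (k : fieldType) (gT : finGroupType) (G : {group gT})
    (b : 'M[k]_#|G|) (l : nat) (n : 'I_l -> nat)
    (S : forall i : 'I_l, mx_representation k G (n i)) : Prop :=
  [/\ forall i, mx_irreducible (S i) /\ in_block b (S i),
      forall i j, mx_rsim (S i) (S j) -> i = j
    & forall (m : nat) (rM : mx_representation k G m),
        mx_irreducible rM -> in_block b rM -> exists i, mx_rsim rM (S i)].

(** rI is (isomorphic to) the module induced to G from the kH-module W: W is
    an H-stable subspace of rI, and rI is the direct sum of the translates W t,
    for t in a transversal of the right cosets H t. *)
Definition induced_from (k : fieldType) (gT : finGroupType) (G H : {group gT})
    (n : nat) (rI : mx_representation k G n) (W : 'M[k]_n) : Prop :=
  [/\ forall h, h \in H -> (W *m rI h <= W)%MS,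
      mxdirect (\sum_(A in rcosets H G) W *m rI (repr A))%MS
    & (\sum_(A in rcosets H G) W *m rI (repr A) :=: 1%:M)%MS].

Definition direct_summand (k : fieldType) (gT : finGroupType) (G : {group gT})
    (m n : nat) (rM : mx_representation k G m)
    (rN : mx_representation k G n) : Prop :=
  exists (U V : 'M[k]_n) (modU : mxmodule rN U),
    [/\ mxmodule rN V, mxdirect (U + V)%MS, (U + V :=: 1%:M)%MS
      & mx_rsim rM (submod_repr modU)].

Definition relatively_projective (k : fieldType) (gT : finGroupType)
    (G H : {group gT}) (m : nat) (rM : mx_representation k G m) : Prop :=
  exists (n : nat) (rI : mx_representation k G n) (W : 'M[k]_n),
    induced_from H rI W /\ direct_summand rM rI.

Definition is_vertex (k : fieldType) (gT : finGroupType) (G Q : {group gT})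
    (m : nat) (rM : mx_representation k G m) : Prop :=
  [/\ Q \subset G, relatively_projective Q rM
    & forall R : {group gT},
        R \subset Q -> relatively_projective R rM -> R :=: Q].

Definition p_regular_elements (p : nat) (gT : finGroupType) (G : {group gT}) :
    {set gT} :=
  [set x in G | p^'.-elt x]%g.

Definition p_regular_classes (p : nat) (gT : finGroupType) (G : {group gT}) :
    {set {set gT}} :=
  [set C in classes G | C \subset p_regular_elements p G].

Definition in_center_p_regular (k : fieldType) (p : nat) (gT : finGroupType)
    (G : {group gT}) (A : 'M[k]_#|G|) : Prop :=
  in_center A /\
  A \in <<[seq regular_repr k G x | x in p_regular_elements p G]>>%VS.

(** The family of the [gset_mx k G C *m b] (class sums times b) is a basis of
    the subspace ZkG_{p'} b. *)
Definition is_class_basis (k : fieldType) (p : nat) (gT : finGroupType)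
    (G : {group gT}) (b : 'M[k]_#|G|) (D : {set {set gT}}) : Prop :=
  let X := [seq gset_mx k G C *m b | C in D] in
  free X /\
  forall w : 'M[k]_#|G|,
    w \in <<X>>%VS <->
    exists z : 'M[k]_#|G|, in_center_p_regular p z /\ w = z *m b.

(** [D b] is the set of classes Cl_{p'}(b); the values of D at matrices that
    are not blocks are irrelevant. *)
Definition is_class_decomposition (k : fieldType) (p : nat)
    (gT : finGroupType) (G : {group gT})
    (D : 'M[k]_#|G| -> {set {set gT}}) : Prop :=
  [/\ forall b, is_block b -> D b \subset p_regular_classes p G,
      forall C, C \in p_regular_classes p G ->
        exists! b, is_block b /\ C \in D b
    & forall b, is_block b -> is_class_basis p b (D b)].

Definition is_defect_group (p : nat) (gT : finGroupType) (G : {group gT})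
    (C : {set gT}) (Q : {group gT}) : Prop :=
  exists2 x, x \in C & (p.-Sylow('C_G[x]) Q)%g.

Definition conj_subset (gT : finGroupType) (G A B : {group gT}) : Prop :=
  exists2 g, g \in G & (A :^ g)%g \subset B.

(* Main.v *)
(** Let [phi_j x = \tr (S_j x)].  If [phi_j x <> 0], then a Sylow p-subgroup of
    the centralizer of [x] is conjugate to a subgroup of the vertex of [S_j]:
    on a module induced from V, the trace of [x] is a sum over the cosets V \ G
    that is constant on orbits of that Sylow subgroup, so only its fixed cosets
    count.  Hence the dual element z_j, the sum of [phi_j (x^-1) x] over the
    p-regular [x], is a combination of class sums of defect at most V_j.

    Multiplication by a central idempotent preserves p-sections, so z_j b = z_j.
    It also preserves the span of the p-regular class sums of defect at most P,
    and since distinct blocks are orthogonal the elements C^ b(C), with b(C) the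
    block to which C is assigned, form a basis of that span.  Therefore
    z_j = \sum_i A_ji C^_i b, where A_ji <> 0 implies Q_i <=_G V_j.  The maps
    phi_j are linearly independent on p-regular elements, so [\det A <> 0], and
    some term of the Leibniz expansion of [\det A] gives the permutation. *)

Require Import Defs.
From HB Require Import structures.
From mathcomp Require Import all_boot all_order all_algebra all_fingroup.
From mathcomp Require Import all_solvable all_field all_character.

Set Implicit Arguments.
Unset Strict Implicit.
Unset Printing Implicit Defensive.

Import GroupScope GRing.Theory.
Local Open Scope ring_scope.

(** * Orbit sums in characteristic p *)

(** A non-trivial orbit of a p-group has size divisible by p, and [F] is constant on it, so its
    contribution vanishes in [k]. *)
Lemma sum_pgroup_fix (k : nzRingType) (p : nat) (pcharkp : p \in [pchar k])
    (aT : finGroupType) (rT : finType) (to : {action aT &-> rT})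
    (R : {group aT}) (A : {set rT}) (F : rT -> k) :
  p.-group R -> [acts R, on A | to] ->
  (forall a x, a \in R -> x \in A -> F (to x a) = F x) ->
  \sum_(x in A) F x = \sum_(x in 'Fix_(A | to)(R)) F x.
Proof.
move=> pR actsA invF; rewrite (bigID (mem 'Fix_to(R))) /=.
suff -> : \sum_(x in A | x \notin 'Fix_to(R)) F x = 0.
  by rewrite addr0; apply: eq_bigl => x; rewrite [RHS]inE.
pose B := A :\: 'Fix_to(R).
have actsB : [acts R, on B | to].
  apply/subsetP=> a Ra; have nRa := subsetP (acts_fix_norm to (normG R)) _ Ra.
  by rewrite (subsetP (astabsD _ _ _)) // inE (subsetP actsA).
rewrite (eq_bigl [in B]); last by move=> x; rewrite !inE andbC.
rewrite (set_partition_big _ (orbit_partition actsB)) /=.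
apply: big1 => _ /imsetP[x Bx ->].
have Ax : x \in A by case/setDP: Bx.
rewrite (eq_bigr (fun=> F x)) => [|_ /imsetP[a Ra ->]]; last exact: invF.
rewrite sumr_const; apply/eqP; rewrite -mulr_natr.
suff /dvdnP[m ->] : (p %| #|orbit to R x|)%N
  by rewrite natrM (pcharf0 pcharkp) !mulr0.
have [_ nfx] := setDP Bx; rewrite card_orbit.
have pn : p.-nat #|R : 'C_R[x | to]| by exact: pnat_dvd (dvdn_indexg _ _) pR.
have /p_natP[[|m] Em] := pn; rewrite Em ?expnS ?dvdn_mulr //.
case/negP: nfx; apply/afixP=> a Ra; move/eqP: Em; rewrite indexg_eq1 => sRC.
by have := subsetP sRC a Ra; rewrite inE => /andP[_ /astab1P].
Qed.

(** On words of length q the q-th iterate of [twist u] is conjugation by [u], so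
    it generates a p-group of permutations when [u] and q are p-powers; its
    fixed points are the constant words in an element commuting with [u]. *)
Definition twist (gT : finGroupType) (u : gT) (s : seq gT) : seq gT :=
  rcons (behead s) (head 1 s ^ u)%g.

Lemma iter_twist (gT : finGroupType) (u : gT) (s : seq gT) (j : nat) :
  (j <= size s)%N ->
  iter j (twist u) s = drop j s ++ [seq (x ^ u)%g | x <- take j s].
Proof.
elim: j => [|j IHj] lt_j_s; first by rewrite drop0 take0 cats0.
rewrite iterS IHj ?(ltnW lt_j_s) // (drop_nth 1%g lt_j_s) (take_nth 1%g lt_j_s).
by rewrite /twist /= map_rcons -rcons_cat.
Qed.

Lemma twist_fix (gT : finGroupType) (u x : gT) (s : seq gT) :
  twist u (x :: s) = x :: s -> s = nseq (size s) x /\ (x ^ u)%g = x.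
Proof.
rewrite /twist /=; move: (x ^ u)%g => y.
elim: s x => [|z s IHs] x /=; first by case.
by case=> <- /IHs[<- ->].
Qed.

(** The hypothesis makes [Phi] invariant under [twist u], so the words that are not fixed cancel.
    The length [q.+1] keeps words nonempty, so that [twist] preserves it. *)
Lemma sum_words (k : nzRingType) (p : nat) (pcharkp : p \in [pchar k])
    (gT : finGroupType) (u : gT) (q : nat) (Phi : seq gT -> k) :
  p.-elt u -> p.-nat q.+1 ->
  (forall x s, Phi (rcons s (x ^ u)%g) = Phi (x :: s)) ->
  \sum_(w : q.+1.-tuple gT) Phi w = \sum_(x in 'C[u]) Phi (nseq q.+1 x).
Proof.
move=> pu pq invPhi.
have size_twist (w : q.+1.-tuple gT) : size (twist u w) == q.+1.
  by rewrite size_rcons size_behead size_tuple.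
pose r w := Tuple (size_twist w).
have r_inj : injective r.
  move=> w1 w2 /(congr1 val) /=; rewrite /twist.
  case: (tupleP w1) => x1 t1; case: (tupleP w2) => x2 t2 /=.
  by move/rcons_inj => [t12 /conjg_inj ->]; congr [tuple of _ :: _];
    apply: val_inj.
have val_iter m w : val (iter m r w) = iter m (twist u) w.
  by elim: m => //= m ->.
have iter_q m w : val (iter (m * q.+1) r w) = [seq (x ^ (u ^+ m))%g | x <- w].
  elim: m => [|m IHm].
    by rewrite /= -[LHS]map_id; apply: eq_map => x; rewrite conjg1.
  rewrite mulSn iterD val_iter iter_twist ?size_tuple //
    take_oversize ?size_tuple //.
  rewrite drop_oversize ?size_tuple //= IHm -map_comp.
  by apply: eq_map => x; rewrite /= expgSr conjgM.
pose R := <[perm r_inj]>%G.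
(* After [q.+1] twists every letter is conjugated once by [u], so the order of the permutation
   divides [#[u] * q.+1]. *)
have pR : p.-group R.
  rewrite /pgroup /= -orderE; apply: (@pnat_dvd _ (#[u] * q.+1)); last first.
    by rewrite pnatM pq andbT.
  rewrite order_dvdn; apply/eqP/permP => w; rewrite permX perm1.
  apply: val_inj; rewrite (eq_iter (permE r_inj)) iter_q expg_order.
  by rewrite -[RHS]map_id; apply: eq_map => x; rewrite conjg1.
have PhiR w : Phi (r w) = Phi w.
  by case: (tupleP w) => x s; rewrite invPhi.
rewrite (eq_bigl [in setT]) => [|w]; last by rewrite inE.
rewrite (sum_pgroup_fix pcharkp pR (to := 'P)) //=.
- rewrite -[RHS](big_imset (fun s : q.+1.-tuple gT => Phi s)
    (h := fun x => nseq_tuple q.+1 x)) /=; last first.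
    by move=> x y _ _ /(congr1 val)[].
  apply: eq_bigl => w; rewrite setTI afix_cycle.
  apply/afix1P/imsetP => [|[x /cent1P cxu ->]].
    rewrite /= apermE permE => /(congr1 val) /=;
      case: (tupleP w) => x s /twist_fix[].
    rewrite size_tuple => def_s xu; exists x.
      by apply/cent1P/commgP/conjg_fixP.
    by apply: val_inj; rewrite /= def_s.
  apply: val_inj; rewrite /= apermE permE /= /twist /= -cats1
    -[[:: _]]/(nseq 1 _).
  have -> : (x ^ u)%g = x by apply/conjg_fixP/commgP.
  by rewrite -nseqD addn1.
- by apply/subsetP=> a _; rewrite !inE /=; apply/subsetP=> w; rewrite !inE.
move=> a w Ra _; have /cycleP[m ->] := Ra.
elim: m => [|m IHm]; first by rewrite act1.
by rewrite expgSr actM /= apermE permE PhiR.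
Qed.

(** * Coefficients in the group algebra *)

(** The row of [A] at the identity lists its coefficients. The value is meaningful only for [A] in
    the group ring and [x] in [G]. *)
Definition gcoef (k : fieldType) (gT : finGroupType) (G : {group gT}) (x : gT)
    (A : 'M[k]_#|G|) : k :=
  gring_row A 0 (gring_index G x).

Lemma gcoef_is_linear (k : fieldType) (gT : finGroupType) (G : {group gT})
    (x : gT) : scalar (@gcoef k gT G x).
Proof. by move=> c A B; rewrite /gcoef linearP !mxE. Qed.

HB.instance Definition _ (k : fieldType) (gT : finGroupType) (G : {group gT})
    (x : gT) :=
  GRing.isLinear.Build k 'M[k]_#|G| k *%R (@gcoef k gT G x)
    (@gcoef_is_linear k gT G x).

Lemma gcoefG (k : fieldType) (gT : finGroupType) (G : {group gT}) :
  {in G &, forall x y, gcoef x (regular_repr k G y) = (x == y)%:R}.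
Proof.
move=> x y Gx Gy; have /matrixP/(_ 0 0) := @gring_projE k gT G x y Gx Gy.
by rewrite /gcoef /gring_proj /= !mxE => ->; case: eqP; rewrite !mxE.
Qed.

Lemma gcoef_sum (k : fieldType) (gT : finGroupType) (G : {group gT}) (y : gT)
    (c : gT -> k) :
  y \in G -> gcoef y (\sum_(x in G) c x *: regular_repr k G x) = c y.
Proof.
move=> Gy; rewrite linear_sum /= (bigD1 y) //= big1 => [|x /andP[Gx x_neq]].
  by rewrite addr0 linearZ /= gcoefG // eqxx mulr1.
by rewrite linearZ /= gcoefG // eq_sym (negbTE x_neq) mulr0.
Qed.

Lemma gring_sum_gcoef (k : fieldType) (gT : finGroupType) (G : {group gT})
    (A : 'M[k]_#|G|) :
  (A \in group_ring k G)%MS ->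
  A = \sum_(x in G) gcoef x A *: regular_repr k G x.
Proof.
case/envelop_mxP=> a def_A; rewrite {1}def_A.
by apply: eq_bigr => x Gx; rewrite def_A gcoef_sum.
Qed.

Lemma gring_gcoef_inj (k : fieldType) (gT : finGroupType) (G : {group gT})
    (A B : 'M[k]_#|G|) :
  (A \in group_ring k G)%MS -> (B \in group_ring k G)%MS ->
  {in G, forall x, gcoef x A = gcoef x B} -> A = B.
Proof.
move=> RA RB eqAB; rewrite (gring_sum_gcoef RA) (gring_sum_gcoef RB).
by apply: eq_bigr => x Gx; rewrite eqAB.
Qed.

Lemma gcoef_mulGr (k : fieldType) (gT : finGroupType) (G : {group gT})
    (A : 'M[k]_#|G|) (x y : gT) :
  (A \in group_ring k G)%MS -> x \in G -> y \in G ->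
  gcoef y (A *m regular_repr k G x) = gcoef (y * x^-1) A.
Proof.
move=> RA Gx Gy; rewrite {1}(gring_sum_gcoef RA) mulmx_suml linear_sum /=.
rewrite (bigD1 (y * x^-1)%g) ?groupM ?groupV //= big1 => [|z /andP[Gz z_neq]].
  rewrite addr0 -scalemxAl linearZ /= -repr_mxM ?groupM ?groupV //.
  by rewrite mulgKV gcoefG ?eqxx ?mulr1.
rewrite -scalemxAl linearZ /= -repr_mxM // gcoefG ?groupM //.
have [def_y|_] := eqVneq y (z * x)%g; last by rewrite mulr0.
by rewrite def_y mulgK eqxx in z_neq.
Qed.

Lemma gcoef_mulGl (k : fieldType) (gT : finGroupType) (G : {group gT})
    (A : 'M[k]_#|G|) (x y : gT) :
  (A \in group_ring k G)%MS -> x \in G -> y \in G ->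
  gcoef y (regular_repr k G x *m A) = gcoef (x^-1 * y) A.
Proof.
move=> RA Gx Gy; rewrite {1}(gring_sum_gcoef RA) mulmx_sumr linear_sum /=.
rewrite (bigD1 (x^-1 * y)%g) ?groupM ?groupV //= big1 => [|z /andP[Gz z_neq]].
  rewrite addr0 -scalemxAr linearZ /= -repr_mxM ?groupM ?groupV //.
  by rewrite mulKVg gcoefG ?eqxx ?mulr1.
rewrite -scalemxAr linearZ /= -repr_mxM // gcoefG ?groupM //.
have [def_y|_] := eqVneq y (x * z)%g; last by rewrite mulr0.
by rewrite def_y mulKg eqxx in z_neq.
Qed.

Lemma gcoefM (k : fieldType) (gT : finGroupType) (G : {group gT})
    (A B : 'M[k]_#|G|) (y : gT) :
  (A \in group_ring k G)%MS -> (B \in group_ring k G)%MS -> y \in G ->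
  gcoef y (A *m B) = \sum_(x in G) gcoef x A * gcoef (x^-1 * y) B.
Proof.
move=> RA RB Gy; rewrite {1}(gring_sum_gcoef RA) mulmx_suml linear_sum /=.
by apply: eq_bigr => x Gx; rewrite -scalemxAl linearZ /= gcoef_mulGl.
Qed.

Lemma in_center_gring (k : fieldType) (gT : finGroupType) (G : {group gT})
    (z : 'M[k]_#|G|) :
  in_center z -> (z \in group_ring k G)%MS.
Proof. by case/center_mxP. Qed.

Lemma in_centerC (k : fieldType) (gT : finGroupType) (G : {group gT})
    (z A : 'M[k]_#|G|) :
  in_center z -> (A \in group_ring k G)%MS -> A *m z = z *m A.
Proof. by case/center_mxP=> _ /[apply]. Qed.

(** Comparing the coefficients of [x * g] on the two sides of [g z = z g] compares [z] at [x ^ g]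
    and at [x]. *)
Lemma in_centerP (k : fieldType) (gT : finGroupType) (G : {group gT})
    (z : 'M[k]_#|G|) :
  in_center z <->
  (z \in group_ring k G)%MS /\
  {in G &, forall x g, gcoef (x ^ g)%g z = gcoef x z}.
Proof.
split=> [Zz | [Rz class_z]].
  split=> [|x g Gx Gg]; first exact: in_center_gring.
  have := in_centerC Zz (envelop_mx_id (regular_repr k G) Gg).
  move/(congr1 (gcoef (x * g))); rewrite gcoef_mulGr ?gcoef_mulGl ?groupM //.
  - by rewrite mulgK -conjgE.
  - exact: in_center_gring.
  exact: in_center_gring.
rewrite /in_center sub_capmx Rz memmx_cent_envelop; apply/centgmxP=> g Gg.
apply: gring_gcoef_inj; rewrite ?envelop_mxM ?envelop_mx_id // => x Gx.
rewrite gcoef_mulGl ?gcoef_mulGr //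
  -(class_z (x * g^-1)%g g) ?groupM ?groupV //.
by congr gcoef; rewrite conjgE mulgKV.
Qed.

Lemma in_center_mul (k : fieldType) (gT : finGroupType) (G : {group gT})
    (z w : 'M[k]_#|G|) :
  in_center z -> in_center w -> in_center (z *m w).
Proof.
move=> Zz Zw; have [Rz Rw] := (in_center_gring Zz, in_center_gring Zw).
apply/center_mxP; split=> [|A RA]; first exact: envelop_mxM.
by rewrite mulmxA (in_centerC Zz RA) -mulmxA (in_centerC Zw RA) mulmxA.
Qed.

Lemma in_center_class_fun (k : fieldType) (gT : finGroupType) (G : {group gT})
    (c : gT -> k) :
  {in G &, forall x g, c (x ^ g)%g = c x} ->
  in_center (\sum_(x in G) c x *: regular_repr k G x).
Proof.
move=> class_c; apply/in_centerP; split=> [|x g Gx Gg]; last first.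
  by rewrite !gcoef_sum ?groupJ ?class_c.
by apply/envelop_mxP; exists c.
Qed.

(** * Powers in the group algebra and p-sections *)

Lemma prod_gring (k : fieldType) (gT : finGroupType) (G : {group gT})
    (c : gT -> k) (s : seq gT) :
  (forall x, x \notin G -> c x = 0) ->
  \prod_(x <- s) (c x *: regular_repr k G x) =
  (\prod_(x <- s) c x) *: regular_repr k G (\prod_(x <- s) x)%g.
Proof.
move=> c0; elim: s => [|x s IHs]; first by rewrite !big_nil scale1r repr_mx1.
rewrite !big_cons {}IHs; have [Gx|/c0->] := boolP (x \in G); last first.
  by rewrite !(scale0r, mul0r).
have [sG|] := boolP (all [in G] s); last first.
  case/allPn=> y s_y /c0 cy0; have ->: \prod_(z <- s) c z = 0.
    by apply/eqP; rewrite prodf_seq_eq0; apply/hasP; exists y; rewrite ?cy0 /=.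
  by rewrite mulr0 !scale0r mulr0.
rewrite repr_mxM //; last by rewrite big_seq group_prod // => y /(allP sG).
by rewrite -mulmxE -scalemxAr -scalemxAl scalerA mulrC.
Qed.

Lemma gring_expn (k : fieldType) (gT : finGroupType) (G : {group gT})
    (c : gT -> k) (q : nat) :
  (forall x, x \notin G -> c x = 0) ->
  (\sum_x c x *: regular_repr k G x) ^+ q =
  \sum_(w : q.-tuple gT)
    (\prod_(x <- w) c x) *: regular_repr k G (\prod_(x <- w) x)%g.
Proof.
move=> c0; rewrite -{1}[q]card_ord -prodr_const bigA_distr_bigA /=.
rewrite (reindex (fun w : q.-tuple gT => [ffun i => tnth w i])) /=; last first.
  exists (fun f => [tuple f i | i < q]) => [w _|f _].
    by apply: eq_from_tnth => i; rewrite tnth_mktuple ffunE.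
  by apply/ffunP=> i; rewrite ffunE tnth_mktuple.
apply: eq_bigr => w _; rewrite -prod_gring // [RHS]big_tuple.
by apply: eq_bigr => i _; rewrite ffunE.
Qed.

(** The linear functional on kG that extends [tau] from [G]. *)
Definition gtrace (k : fieldType) (gT : finGroupType) (G : {group gT})
    (tau : gT -> k) (A : 'M[k]_#|G|) : k :=
  \sum_(x in G) gcoef x A * tau x.

Lemma gtrace_is_linear (k : fieldType) (gT : finGroupType) (G : {group gT})
    (tau : gT -> k) : scalar (@gtrace k gT G tau).
Proof.
move=> c A B; rewrite /gtrace mulr_sumr -big_split; apply: eq_bigr => x _.
by rewrite linearP mulrDl -mulrA.
Qed.

HB.instance Definition _ (k : fieldType) (gT : finGroupType) (G : {group gT})
    (tau : gT -> k) :=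
  GRing.isLinear.Build k 'M[k]_#|G| k *%R (@gtrace k gT G tau)
    (@gtrace_is_linear k gT G tau).

Lemma gtraceG (k : fieldType) (gT : finGroupType) (G : {group gT})
    (tau : gT -> k) (x : gT) :
  x \in G -> gtrace tau (regular_repr k G x) = tau x.
Proof.
move=> Gx; rewrite /gtrace (bigD1 x) //= gcoefG // eqxx mul1r big1 ?addr0 //.
by move=> y /andP[Gy /negbTE y_neq]; rewrite gcoefG // y_neq mul0r.
Qed.

(** A noncommutative Frobenius formula. The power expands over words, and the value on a word is
    invariant under twisting by the inverse of [u], since [tau] is cyclic and [u] fixes the
    coefficients of [A]. Only constant words survive. *)
Lemma gtrace_expn (k : fieldType) (p : nat) (pcharkp : p \in [pchar k])
    (gT : finGroupType) (G : {group gT}) (tau : gT -> k)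
    (A : 'M[k]_#|G|) (u : gT) (q : nat) :
  {in G &, forall x y, tau (x * y)%g = tau (y * x)%g} ->
  (A \in group_ring k G)%MS -> u \in G -> p.-elt u -> p.-nat q.+1 ->
  A *m regular_repr k G u = regular_repr k G u *m A ->
  gtrace tau (regular_repr k G u *m A ^+ q.+1) =
  \sum_(x in 'C_G[u]) gcoef x A ^+ q.+1 * tau (u * x ^+ q.+1)%g.
Proof.
move=> tauC RA Gu pu pq cAu.
(* [gcoef] need not vanish outside [G]; cutting it off lets the words range over all of [gT]. *)
pose c x := if x \in G then gcoef x A else 0.
have c0 x : x \notin G -> c x = 0 by rewrite /c => /negbTE->.
have def_A : A = \sum_x c x *: regular_repr k G x.
  rewrite {1}(gring_sum_gcoef RA) big_mkcond; apply: eq_bigr => x _.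
  by rewrite /c; case: ifP => //; rewrite scale0r.
pose Phi s := (\prod_(x <- s) c x) * tau (u * \prod_(x <- s) x)%g.
have c_conj x : c (x ^ u^-1)%g = c x.
  rewrite /c memJ_norm ?groupV ?(subsetP (normG G)) //; case: ifP => // Gx.
  have := congr1 (gcoef (u * x)%g) cAu.
  rewrite gcoef_mulGr ?gcoef_mulGl ?groupM // mulKg conjgE invgK mulgA.
  by [].
have PhiE s : {subset s <= G} ->
  forall x, Phi (rcons s (x ^ u^-1)%g) = Phi (x :: s).
  move=> sG x; rewrite /Phi !big_rcons !big_cons /= c_conj.
  have [Gx|/c0->] := boolP (x \in G); last by rewrite !(mulr0, mul0r).
  have Gs : (\prod_(y <- s) y)%g \in G
    by rewrite big_seq group_prod // => y /sG.
  rewrite (mulrC (c x)); congr (_ * _).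
  (* Cyclicity is used twice: [tau (u s u x u^-1) = tau (s u x) = tau (u x s)]. *)
  rewrite mulgA conjgE invgK !mulgA tauC ?groupM ?groupV //.
  by rewrite -!mulgA mulKg tauC ?groupM // mulgA.
have Phi0 s : ~~ all [in G] s -> Phi s = 0.
  case/allPn=> y s_y /c0 cy0;
    rewrite /Phi (_ : \prod_(z <- s) c z = 0) ?mul0r //.
  by apply/eqP; rewrite prodf_seq_eq0; apply/hasP; exists y; rewrite ?cy0 /=.
transitivity (\sum_(w : q.+1.-tuple gT) Phi w).
  rewrite {1}def_A gring_expn // mulmx_sumr linear_sum /=.
  apply: eq_bigr => w _; have [/allP wG|w'G] := boolP (all [in G] w).
    rewrite -scalemxAr linearZ /= -repr_mxM ?gtraceG ?groupM //.
      by rewrite big_seq group_prod // => y /wG.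
    by rewrite big_seq group_prod // => y /wG.
  rewrite Phi0 // (_ : \prod_(z <- w) c z = 0) ?scale0r ?mulmx0 ?linear0 //.
  case/allPn: w'G => y w_y /c0 cy0.
  by apply/eqP; rewrite prodf_seq_eq0; apply/hasP; exists y; rewrite ?cy0 /=.
rewrite (sum_words pcharkp (u := u^-1)) // ?p_eltV //; last first.
  move=> x s; have [/allP/PhiE-> //|sG'] := boolP (all [in G] s).
  by rewrite !Phi0 //= ?(negbTE sG') ?andbF // all_rcons (negbTE sG') andbF.
rewrite (_ : 'C[u^-1] = 'C[u])%g; last first.
  by apply/setP=> x; apply/cent1P/cent1P => /commuteV; rewrite ?invgK.
rewrite big_mkcond [RHS]big_mkcond; apply: eq_bigr => x _; rewrite [in RHS]inE.
case: (x \in 'C[u]); rewrite ?andbT ?andbF //.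
rewrite /Phi !big_nseq iter_mulr_1 iter_mulg_1 /c; case: ifP => // _.
by rewrite expr0n mul0r.
Qed.

(** The exponent is [p ^ n]. As [n] is at least [#|G|], it kills the p-part; as [n] is a multiple of
    [totient m], Euler's theorem makes it 1 modulo the order of the p-regular part. *)
Lemma p_regular_part_expn (p : nat) (gT : finGroupType) (G : {group gT}) :
  prime p ->
  exists2 q, p.-nat q.+1 & forall x, x \in G -> (x ^+ q.+1 = x.`_p^')%g.
Proof.
move=> p_pr; set m := (#|G|`_p^')%N; pose n := (totient m * #|G|)%N.
have pn_gt0 : (0 < p ^ n)%N by rewrite expn_gt0 prime_gt0.
exists (p ^ n).-1; rewrite prednK //; first by rewrite pnatX pnat_id.
move=> x Gx; rewrite -{1}(consttC p x) expgMn; last first.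
  exact: (centsP (cycle_abelian x)) (cycle_constt p x) _ (cycle_constt p^' x).
have -> : (x.`_p ^+ (p ^ n) = 1)%g.
  apply/eqP; rewrite -order_dvdn order_constt p_part dvdn_exp2l //.
  apply: (@leq_trans #|G|); last first.
    by rewrite leq_pmull // totient_gt0 part_gt0.
  apply: leq_trans (subset_leq_card (_ : <[x]> \subset G)%g); last first.
    by rewrite cycle_subG.
  by rewrite ltnW // -orderE ltn_logl ?order_gt0.
rewrite mul1g -[RHS]expg1; apply/eqP; rewrite eq_expg_mod_order.
have dvd_m : (#[x.`_p^']%g %| m)%N.
  by rewrite order_constt partn_dvd // order_dvdG.
rewrite -(modn_dvdm (p ^ n) dvd_m) -(modn_dvdm 1 dvd_m) expnM -modnXm.
rewrite Euler_exp_totient ?modnXm ?exp1n //.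
exact: pnat_coprime (pnat_id p_pr) (part_pnat p^' _).
Qed.

(** With y = u s the decomposition of [y] into its p-part and p-regular part,
    e y = u (e s)^q for any large power q of p fixing s, so [gtrace_expn] expands
    the trace of e y over elements whose p-part is u. *)
Lemma gtrace_section (k : fieldType) (p : nat) (pcharkp : p \in [pchar k])
    (gT : finGroupType) (G : {group gT}) (tau : gT -> k)
    (e : 'M[k]_#|G|) (y : gT) :
  {in G &, forall x z, tau (x * z)%g = tau (z * x)%g} ->
  in_center e -> e *m e = e -> y \in G ->
  (forall x, x \in G -> (x.`_p = y.`_p)%g -> tau x = 0) ->
  gtrace tau (e *m regular_repr k G y) = 0.
Proof.
move=> tauC Ze ee Gy tau0; have p_pr := pcharf_prime pcharkp.
have [q pq expq] := p_regular_part_expn G p_pr.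
have [Gu Gs] : (y.`_p \in G /\ y.`_p^' \in G)%g by rewrite !groupX.
have Re := in_center_gring Ze; pose aG := regular_repr k G.
have RG x : x \in G -> (aG x \in group_ring k G)%MS by exact: envelop_mx_id.
have eC x : x \in G -> aG x *m e = e *m aG x by move=> Gx;
  exact: in_centerC Ze (RG _ Gx).
pose A := e *m aG (y.`_p^')%g.
have cus : (commute y.`_p y.`_p^')%g.
  exact: (centsP (cycle_abelian y)) (cycle_constt p y) _ (cycle_constt p^' y).
(* The two factors of [A] commute, [e] is idempotent, and the power fixes the p-regular part of
   [y]. *)
have expA : A ^+ q.+1 = A.
  have -> : A ^+ q.+1 = e ^+ q.+1 * aG (y.`_p^')%g ^+ q.+1.
    by rewrite -exprMn_comm //; exact: esym (eC _ Gs).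
  have -> : e ^+ q.+1 = e.
    by elim: q {pq expq} => // q IHq; rewrite exprS IHq.
  have expG m : aG (y.`_p^')%g ^+ m = aG (y.`_p^' ^+ m)%g.
    elim: m => [|m IHm]; first by rewrite repr_mx1.
    by rewrite exprS expgS repr_mxM ?groupX // IHm.
  by rewrite expG expq // (constt_p_elt (p_elt_constt _ _)).
have -> : e *m aG y = aG (y.`_p)%g *m A ^+ q.+1.
  by rewrite expA mulmxA eC // -mulmxA -repr_mxM // consttC.
have RA : (A \in group_ring k G)%MS by rewrite envelop_mxM ?RG.
have cAu : A *m aG (y.`_p)%g = aG (y.`_p)%g *m A.
  by rewrite -mulmxA -repr_mxM // -cus repr_mxM // !mulmxA eC.
rewrite (gtrace_expn pcharkp tauC RA Gu (p_elt_constt _ _) pq cAu).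
(* [x ^+ q.+1] is p-regular and commutes with the p-part of [y], so the product has that same p-part
   and [tau] vanishes on it. *)
apply: big1 => x /setIP[Gx /cent1P cxu]; rewrite tau0 ?mulr0 ?groupM ?groupX //.
rewrite consttM; last by apply: commuteX; apply: commute_sym.
rewrite expq // (constt_p_elt (p_elt_constt _ _)).
have /constt1P -> : p^'.-elt (x.`_p^')%g by exact: p_elt_constt.
exact: mulg1.
Qed.

(** With [tau x] the coefficient of [z] at the inverse of [x], the coefficient of [y] in [e z] is
    the value of [gtrace tau] at [e] times the inverse of [y]. Inversion commutes with taking
    p-parts, so [gtrace_section] applies. *)
Lemma gcoef_section (k : fieldType) (p : nat) (pcharkp : p \in [pchar k])
    (gT : finGroupType) (G : {group gT}) (z e : 'M[k]_#|G|) (y : gT) :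
  in_center z -> in_center e -> e *m e = e -> y \in G ->
  (forall x, x \in G -> (x.`_p = y.`_p)%g -> gcoef x z = 0) ->
  gcoef y (z *m e) = 0.
Proof.
move=> Zz Ze ee Gy z0; have [Rz class_z] := (in_centerP z).1 Zz.
have Re := in_center_gring Ze.
have RG x : x \in G -> (regular_repr k G x \in group_ring k G)%MS.
  exact: envelop_mx_id.
have Gy' : y^-1%g \in G by rewrite groupV.
pose tau x := gcoef (x^-1)%g z; rewrite -(in_centerC Zz Re).
have <- : gtrace tau (e *m regular_repr k G (y^-1)%g) = gcoef y (e *m z).
  transitivity (gcoef 1 (e *m regular_repr k G (y^-1)%g *m z)).
    rewrite gcoefM ?envelop_mxM ?RG //.
    by apply: eq_bigr => x _; rewrite mulg1.
  rewrite -mulmxA (in_centerC Zz (RG _ Gy')) mulmxA.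
  by rewrite gcoef_mulGr ?envelop_mxM // mul1g invgK.
apply: (gtrace_section pcharkp) => // [x1 x2 Gx1 Gx2|x Gx xy]; rewrite /tau.
  rewrite -(class_z (x1 * x2)^-1%g x1) ?groupV ?groupM //.
  by rewrite conjgE !invMg !mulgA mulgKV.
apply: z0; rewrite ?groupV //;
by rewrite consttV xy consttV invgK.
Qed.

(** * Traces of simple modules *)

Lemma gring_opX (k : fieldType) (gT : finGroupType) (G : {group gT})
    (n : nat) (rG : mx_representation k G n) (A : 'M[k]_#|G|) (q : nat) :
  (A \in group_ring k G)%MS ->
  gring_op rG (A ^+ q) = (gring_op rG A : 'M_n) ^+ q.
Proof.
move=> RA; elim: q => [|q IHq]; first by rewrite !expr0 [LHS]gring_op1.
by rewrite !exprSr gring_opM // IHq.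
Qed.

(** An absolutely irreducible image is the full matrix algebra. [lift] is a mere section, with no
    linearity or multiplicativity claimed. *)
Lemma gring_op_onto (k : fieldType) (gT : finGroupType) (G : {group gT})
    (n : nat) (rG : mx_representation k G n) :
  mx_absolutely_irreducible rG ->
  exists lift : 'M[k]_n -> 'M[k]_#|G|,
    forall X, (lift X \in group_ring k G)%MS /\ gring_op rG (lift X) = X.
Proof.
case/mx_abs_irrP=> _ [a_ def_a].
exists (fun X => \sum_(x in G) a_ x X *: regular_repr k G x) => X.
split; first by apply/envelop_mxP; exists (fun x => a_ x X).
rewrite [RHS]def_a linear_sum; apply: eq_bigr => x Gx.
by rewrite linearZ /= gring_opG.
Qed.

(** The inclusion of kernels makes [rG1] a module over the full matrix algebra
    that is the image of [rG2]; a nonzero vector fixed by [delta_mx i0 i0] then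
    spans a copy of [rG2] in [rG1]. *)
Lemma gring_op_ker_rsim (k : fieldType) (gT : finGroupType) (G : {group gT})
    (n1 n2 : nat) (rG1 : mx_representation k G n1)
    (rG2 : mx_representation k G n2) :
  mx_irreducible rG1 -> mx_absolutely_irreducible rG2 ->
  (forall A, (A \in group_ring k G)%MS ->
    gring_op rG2 A = 0 -> gring_op rG1 A = 0) ->
  mx_rsim rG2 rG1.
Proof.
move=> irr1 abs2 ker21.
have irr2 := mx_abs_irrW abs2.
have [n1_gt0 full1] := (mx_irrP rG1).1 irr1.
have [n2_gt0 full2] := (mx_irrP rG2).1 irr2.
have [lift liftP] := gring_op_onto abs2.
(* The inclusion of kernels makes the value independent of the lift, so [psi] is an algebra
   homomorphism even if [lift] is not. *)
pose psi X := gring_op rG1 (lift X).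
have psi_op A : (A \in group_ring k G)%MS ->
  gring_op rG1 A = psi (gring_op rG2 A).
  move=> RA; apply/eqP; rewrite -subr_eq0 -linearB; apply/eqP/ker21.
    by rewrite linearB /= addmx_sub ?eqmx_opp // (liftP _).1.
  by rewrite linearB /= (liftP _).2 subrr.
have psi_sum (I : finType) (c : I -> k) (X : I -> 'M_n2) :
    psi (\sum_i c i *: X i) = \sum_i c i *: psi (X i).
  have RX : (\sum_i c i *: lift (X i) \in group_ring k G)%MS.
    by rewrite linear_sum summx_sub // => i _;
      rewrite linearZ scalemx_sub ?(liftP _).1.
  have := psi_op _ RX; rewrite !linear_sum /= => def_psi.
  rewrite (eq_bigr (fun i => gring_op rG1 (c i *: lift (X i)))) => [|i _].
    rewrite {}def_psi; congr psi; apply: eq_bigr => i _.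
    by rewrite linearZ /= (liftP _).2.
  by rewrite linearZ.
have psiM X Y : psi (X *m Y) = psi X *m psi Y.
  transitivity (gring_op rG1 (lift X *m lift Y)).
    rewrite psi_op ?envelop_mxM ?(liftP _).1 //.
    by rewrite gring_opM ?(liftP _).1 // !(liftP _).2.
  by rewrite gring_opM ?(liftP _).1.
have psi1 : psi 1%:M = 1%:M.
  by rewrite -(gring_op1 rG2) -psi_op ?gring_op1 ?envelop_mx1.
pose i0 := Ordinal n2_gt0.
(* Otherwise [psi] kills every [delta_mx i i], which factors through [delta_mx i0 i0], and hence
   kills 1. *)
have psi00 : psi (delta_mx i0 i0) != 0.
  apply/eqP=> psi00; have /eqP := psi1; apply/negP.
  have -> : 1%:M = \sum_(i < n2) 1 *: (delta_mx i i : 'M[k]_n2).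
    rewrite mx1_sum_delta; by apply: eq_bigr => i _; rewrite scale1r.
  rewrite psi_sum big1 => [|i _].
    by rewrite eq_sym -mxrank_eq0 mxrank1 -lt0n.
  rewrite scale1r -(mul_delta_mx i0) psiM -[delta_mx i0 i](mul_delta_mx i0).
  by rewrite psiM psi00 mul0mx mulmx0.
have [r nz_r] : exists r, row r (psi (delta_mx i0 i0)) != 0.
  apply/existsP; apply: contraNT psi00; rewrite negb_exists => /forallP all0.
  by apply/eqP/row_matrixP=> r; rewrite row0; apply/eqP; rewrite -[_ == _]negbK.
pose B := \matrix_(i < n2) row r (psi (delta_mx i0 i)).
have nzB : B != 0.
  by apply: contraNneq nz_r => B0;
    rewrite -(rowK (fun i => row r (psi (delta_mx i0 i)))) -/B B0 row0.
have homB x : x \in G -> rG2 x *m B = B *m rG1 x.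
  move=> Gx; apply/row_matrixP=> i;
    rewrite row_mul [RHS]row_mul rowK -[RHS]row_mul.
  have <- : psi (rG2 x) = rG1 x.
    by rewrite -(gring_opG rG2 Gx) -psi_op ?gring_opG ?envelop_mx_id.
  rewrite -psiM mulmx_sum_row.
  have -> : delta_mx i0 i *m rG2 x =
      \sum_j rG2 x i j *: (delta_mx i0 j : 'M_n2).
    apply/matrixP=> a b; rewrite summxE mxE (bigD1 i) //= big1 =>
      [|j /negbTE j_i].
      rewrite !mxE eqxx andbT addr0 (bigD1 b) //= big1 => [|j /negbTE j_b].
        by rewrite !mxE eqxx andbT addr0 mulrC.
      by rewrite !mxE [b == j]eq_sym j_b andbF mulr0.
    by rewrite !mxE j_i andbF mul0r.
  rewrite psi_sum linear_sum; apply: eq_bigr => j _.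
  by rewrite linearZ /= rowK mxE.
(* Schur's lemma: the kernel of [B] is a proper submodule of [rG2], and its image is a nonzero
   submodule of [rG1]. *)
have freeB : row_free B.
  rewrite -kermx_eq0; apply: contraNT nzB => nzK.
  have modK : mxmodule rG2 (kermx B).
    apply/mxmoduleP=> x Gx; apply/sub_kermxP.
    by rewrite -mulmxA homB // mulmxA mulmx_ker mul0mx.
  have := full2 _ modK nzK; rewrite -sub1mx => /sub_kermxP.
  by rewrite mul1mx => ->.
have fullB : row_full B.
  have : row_full <<B>>%MS.
    apply: full1; last by rewrite (eqmx_eq0 (genmxE _)).
    rewrite (eqmx_module _ (genmxE B)); apply/mxmoduleP=> x Gx.
    by rewrite -homB // submxMl.
  by rewrite /row_full genmxE.
exists B => //.
by move: freeB fullB; rewrite /row_free /row_full => /eqP-> /eqP.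
Qed.

Lemma delta_mx_conj (R : comNzRingType) (m n q r : nat) (M : 'M[R]_(n, q))
    (i : 'I_m) (s : 'I_n) (t : 'I_q) (j : 'I_r) :
  delta_mx i s *m M *m delta_mx t j = M s t *: delta_mx i j.
Proof.
rewrite -(mul_delta_mx (0 : 'I_1) i s) -(mul_delta_mx (0 : 'I_1) t j).
rewrite mulmxA -(mulmxA (delta_mx i 0)) -(mulmxA (delta_mx i 0)).
rewrite -rowE -colE [col t (row s M)]mx11_scalar !mxE mul_mx_scalar.
by rewrite -scalemxAl mul_delta_mx.
Qed.

(** Were the annihilator of [rG2] contained in that of [rG1], [gring_op_ker_rsim] would give an
    isomorphism. So some [A] killing [rG2] has a nonzero entry on [rG1]. *)
Lemma gring_op_separate (k : fieldType) (gT : finGroupType) (G : {group gT})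
    (n1 n2 : nat) (rG1 : mx_representation k G n1)
    (rG2 : mx_representation k G n2) :
  mx_absolutely_irreducible rG1 -> mx_absolutely_irreducible rG2 ->
  ~ mx_rsim rG1 rG2 ->
  exists A, [/\ (A \in group_ring k G)%MS, gring_op rG1 A = 1%:M
    & gring_op rG2 A = 0].
Proof.
move=> abs1 abs2 nsim12; have [lift liftP] := gring_op_onto abs1.
pose K := (kermx (lin_mx (gring_op rG2)) :&: group_ring k G)%MS.
have K_P A : (A \in K)%MS = (gring_op rG2 A == 0) && (A \in group_ring k G)%MS.
  rewrite sub_capmx; congr (_ && _); apply/sub_kermxP/eqP; rewrite mul_vec_lin.
    by move/(canRL mxvecK); rewrite linear0.
  by move=> A0; apply: (canLR vec_mxK); rewrite linear0.
have [K1|] := boolP (K <= kermx (lin_mx (gring_op rG1)))%MS.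
  case: nsim12; apply: mx_rsim_sym.
  apply: gring_op_ker_rsim => // [|A RA A0]; first exact: mx_abs_irrW.
  have /submx_trans/(_ K1)/sub_kermxP : (A \in K)%MS by rewrite K_P A0 eqxx.
  by rewrite mul_vec_lin => /(canRL mxvecK); rewrite linear0.
case/row_subPn=> h Kh; pose A := vec_mx (row h K).
have /andP[/eqP A2 RA] : (gring_op rG2 A == 0) && (A \in group_ring k G)%MS.
  by rewrite -K_P vec_mxK row_sub.
have [s [t nz_st]] : exists s t, gring_op rG1 A s t != 0.
  suff /existsP[s /existsP[t st]] :
    [exists s, exists t, gring_op rG1 A s t != 0].
    by exists s, t.
  apply: contraNT Kh; rewrite negb_exists => /forallP A0.
  have A1 : gring_op rG1 A = 0.
    apply/matrixP=> s t; rewrite [RHS]mxE; apply/eqP; rewrite -[_ == _]negbK.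
    by have := A0 s; rewrite negb_exists => /forallP/(_ t).
  apply/sub_kermxP; rewrite -[row h K]vec_mxK mul_vec_lin.
  by apply: (canLR vec_mxK); rewrite linear0.
(* On [rG1] the summand at [i] acts as [delta_mx i i]; on [rG2] the factor [A] makes it vanish. *)
pose B := \sum_i (gring_op rG1 A s t)^-1 *:
  (lift (delta_mx i s) *m A *m lift (delta_mx t i)).
exists B; split.
- rewrite linear_sum summx_sub // => i _; rewrite linearZ scalemx_sub //.
  by rewrite !envelop_mxM ?(liftP _).1.
- rewrite linear_sum mx1_sum_delta; apply: eq_bigr => i _.
  rewrite linearZ /= !gring_opM ?(liftP _).1 // !(liftP _).2.
  by rewrite delta_mx_conj scalerA mulVf // scale1r.
rewrite linear_sum big1 // => i _.
by rewrite linearZ /= !gring_opM ?(liftP _).1 // A2 mulmx0 mul0mx scaler0.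
Qed.

(** The product of elements separating [S i] from each other [S j] acts as 1 on [S i] and as 0 on
    the rest. *)
Lemma gring_op_dual (k : closedFieldType) (gT : finGroupType) (G : {group gT})
    (l : nat) (n : 'I_l -> nat) (S : forall i, mx_representation k G (n i)) :
  (forall i, mx_irreducible (S i)) ->
  (forall i j, mx_rsim (S i) (S j) -> i = j) ->
  forall i, exists A,
    [/\ (A \in group_ring k G)%MS,
        gring_op (S i) A *m gring_op (S i) A = gring_op (S i) A,
        \tr (gring_op (S i) A) = 1
      & forall j, j != i -> gring_op (S j) A = 0].
Proof.
move=> irrS simS i.
have absS j : mx_absolutely_irreducible (S j).
  exact: group_closure_closed_field (irrS j).
have [A [RA A1 A0]] : exists A, [/\ (A \in group_ring k G)%MS,
    gring_op (S i) A = 1%:M & forall j, j \in rem i (enum 'I_l) ->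
      gring_op (S j) A = 0].
  have : i \notin rem i (enum 'I_l) by rewrite mem_rem_uniqF ?enum_uniq.
  elim: (rem i _) => [_|j s IHs].
    by exists 1%:M; split=> //; [rewrite envelop_mx1 | rewrite gring_op1].
  rewrite inE negb_or => /andP[i_j /IHs[A [RA A1 A0]]].
  have [B [RB B1 B0]] : exists B, [/\ (B \in group_ring k G)%MS,
      gring_op (S i) B = 1%:M & gring_op (S j) B = 0].
    by apply: gring_op_separate => // /simS/eqP; apply/negP.
  exists (A *m B); split=> [||h]; first by rewrite envelop_mxM.
    by rewrite gring_opM // A1 B1 mulmx1.
  rewrite inE gring_opM // => /orP[/eqP-> | /A0->]; first by rewrite B0 mulmx0.
  by rewrite mul0mx.
have [lift liftP] := gring_op_onto (absS i).
have n_gt0 : (0 < n i)%N by case/andP: (absS i).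
(* A matrix unit has trace 1, whereas the trace of the identity is the degree, which may be 0 in
   [k]. *)
pose i0 := Ordinal n_gt0; exists (A *m lift (delta_mx i0 i0)).
have RD := (liftP (delta_mx i0 i0)).1.
rewrite envelop_mxM // gring_opM // A1 mul1mx (liftP _).2 mul_delta_mx.
split=> // [|j j_i].
  rewrite /mxtrace (bigD1 i0) //= big1 => [|j /negbTE j_i0].
    by rewrite mxE eqxx addr0.
  by rewrite mxE j_i0.
by rewrite gring_opM // A0 ?mul0mx //
  (mem_rem_uniq _ (enum_uniq _)) inE j_i mem_enum.
Qed.

(** If A acts as a rank-one idempotent on [S i] and as 0 on the others, so does
    A^q for q a large power of p; the trace of A^q only involves q-th powers of
    group elements, which are p-regular. *)
Lemma p_regular_traces_free (k : closedFieldType) (p : nat)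
    (pcharkp : p \in [pchar k]) (gT : finGroupType) (G : {group gT})
    (l : nat) (n : 'I_l -> nat) (S : forall i, mx_representation k G (n i))
    (a : 'I_l -> k) :
  (forall i, mx_irreducible (S i)) ->
  (forall i j, mx_rsim (S i) (S j) -> i = j) ->
  (forall x, x \in G -> p^'.-elt x -> \sum_j a j * \tr (S j x) = 0) ->
  forall i, a i = 0.
Proof.
move=> irrS simS a0 i; have [A [RA A_id A_tr A0]] := gring_op_dual irrS simS i.
pose tau x := \sum_j a j * \tr (S j x).
have tauC : {in G &, forall x y, tau (x * y)%g = tau (y * x)%g}.
  move=> x y Gx Gy; apply: eq_bigr => j _.
  by rewrite !repr_mxM // mxtrace_mulC.
have tauE B : (B \in group_ring k G)%MS ->
  gtrace tau B = \sum_j a j * \tr (gring_op (S j) B).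
  move=> RB; rewrite {2}(gring_sum_gcoef RB) /gtrace.
  rewrite (eq_bigr (fun x => \sum_j gcoef x B * (a j * \tr (S j x))));
    last first.
    by move=> x _; rewrite mulr_sumr.
  rewrite exchange_big; apply: eq_bigr => j _; rewrite !linear_sum mulr_sumr.
  by apply: eq_bigr => x Gx; rewrite !linearZ /= gring_opG // mulrCA.
have tauA q : gtrace tau (A ^+ q.+1) = a i.
  have RAq : (A ^+ q.+1 \in group_ring k G)%MS.
    by elim: q => // q IHq; rewrite exprS envelop_mxM.
  rewrite tauE // (bigD1 i) //= big1 => [|j j_i]; rewrite gring_opX //.
    rewrite (_ : _ ^+ q.+1 = gring_op (S i) A) ?A_tr ?mulr1 ?addr0 //.
    by elim: q {RAq} => // q IHq; rewrite exprS IHq.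
  by rewrite A0 // expr0n mxtrace0 mulr0.
have [q pq expq] := p_regular_part_expn G (pcharf_prime pcharkp).
have cA1 : A *m regular_repr k G 1%g = regular_repr k G 1%g *m A.
  by rewrite repr_mx1 mulmx1 mul1mx.
have := gtrace_expn pcharkp tauC RA (group1 G) (p_elt1 _ _) pq cA1.
rewrite repr_mx1 mul1mx tauA => ->; apply: big1 => x /setIP[Gx _].
by rewrite mul1g expq // /tau a0 ?mulr0 ?groupX // p_elt_constt.
Qed.

(** * Traces on relatively projective modules *)

(** With [v] the inclusion and [t] the projection, [t *m v] is the projector and [v *m t] is 1; the
    trace is cyclic. *)
Lemma trace_summand (k : fieldType) (gT : finGroupType) (G : {group gT})
    (n : nat) (rG : mx_representation k G n) (U V : 'M[k]_n)
    (modU : mxmodule rG U) :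
  mxdirect (U + V)%MS ->
  forall x, x \in G ->
  \tr (submod_repr modU x) = \tr (rG x *m proj_mx U V).
Proof.
move=> /mxdirect_addsP dxUV x Gx.
pose v := val_submod (1%:M : 'M_(\rank U)); pose t := in_submod U (proj_mx U V).
have tv : t *m v = proj_mx U V.
  by rewrite /v -val_submodE in_submodK // -[proj_mx U V]mul1mx proj_mx_sub.
have vt : v *m t = 1%:M.
  rewrite /t in_submodE mulmxA -in_submodE proj_mx_id ?val_submod1 //.
  exact: val_submodK.
have vx : v *m rG x = submod_repr modU x *m v.
  have := val_submodJ modU (1%:M : 'M_(\rank U)) Gx.
  by rewrite mul1mx val_submodE.
by rewrite -tv mulmxA [RHS]mxtrace_mulC mulmxA vx -mulmxA vt mulmx1.
Qed.

(** The projector [e] onto the summand commutes with [G], and the projections [E A] onto the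
    translates cut the trace into terms [F A]. Since [R] centralizes [x], [F] is constant on
    [R]-orbits, so a nonzero trace forces a coset fixed by [R]. *)
Lemma relatively_projective_trace (k : fieldType) (p : nat)
    (pcharkp : p \in [pchar k]) (gT : finGroupType) (G H R : {group gT})
    (n : nat) (rM : mx_representation k G n) (x : gT) :
  H \subset G -> relatively_projective H rM -> x \in G ->
  R \subset 'C_G[x]%g -> p.-group R -> \tr (rM x) != 0 ->
  exists2 g, g \in G & (R :^ g \subset H)%g.
Proof.
move=> sHG [m [rI [W [[stabW dxW sumW] [U [V [modU [modV dxUV sumUV simM]]]]]]]].
move=> Gx sRC pR; rewrite (mxtrace_rsim simM Gx) (trace_summand modU dxUV Gx).
pose WA (A : {set gT}) := W *m rI (repr A).
have [E WE] : exists E, forall A B,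
    A \in rcosets H G -> B \in rcosets H G ->
    forall C : 'M_m, (C <= WA B)%MS -> C *m E A = if A == B then C else 0.
  exists (fun A => proj_mx (WA A) (\sum_(B in rcosets H G | B != A) WA B)%MS).
  move=> A B HA HB C sCB; have dxA := mxdirect_sumsP dxW A HA.
  case: eqP sCB => [<- | /eqP A_B] sCB; first by rewrite proj_mx_id.
  rewrite proj_mx_0 //; apply: submx_trans sCB _.
  by rewrite (sumsmx_sup B) // HB eq_sym.
have eqW (M1 M2 : 'M_m) :
    (forall B, B \in rcosets H G -> WA B *m M1 = WA B *m M2) -> M1 = M2.
  move=> eq12; have /sub_sumsmxP[u def1] :
    (1%:M <= \sum_(B in rcosets H G) WA B)%MS.
    by rewrite sumW.
  rewrite -[M1]mul1mx -[M2]mul1mx def1 !mulmx_suml.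
  by apply: eq_bigr => B HB; rewrite -!(mulmxA (u B)) eq12.
have sum_E : \sum_(A in rcosets H G) E A = 1%:M.
  apply: eqW => B HB; rewrite mulmx1 mulmx_sumr (bigD1 B) //= big1 =>
    [|A /andP[HA A_B]].
    by rewrite (WE B B) // eqxx addr0.
  by rewrite (WE A B) // (negbTE A_B).
have WrI A y : A \in rcosets H G -> y \in A -> (W *m rI y <= WA A)%MS.
  case/rcosetsP=> a Ga def_A Ay; rewrite /WA.
  have := mem_repr y Ay; rewrite {}def_A in Ay *; set b := repr _ => Hb.
  have HG z : z \in (H :* a)%g -> z \in G.
    by case/rcosetP=> h Hh ->; rewrite groupM // (subsetP sHG).
  have Hyb : (y * b^-1 \in H)%g.
    case/rcosetP: Ay => h Hh ->; case/rcosetP: Hb => h' Hh' ->.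
    by rewrite invMg mulgA mulgK groupM ?groupV.
  rewrite -[y](mulgKV b) repr_mxM ?(HG b) ?(subsetP sHG _ Hyb) // mulmxA.
  by rewrite submxMr // stabW.
(* The action of [g] carries the translate at [A] to the one at [A :* g], hence conjugates the
   projections. *)
have E_J A g : A \in rcosets H G -> g \in G ->
    E (A :* g)%g = rI (g^-1)%g *m E A *m rI g.
  move=> HA Gg; apply: eqW => B HB.
  have rcosJ y C : y \in G -> C \in rcosets H G -> (C :* y)%g \in rcosets H G.
    move=> Gy /rcosetsP[c Gc ->]; rewrite -rcosetM.
    by apply/rcosetsP; exists (c * y)%g; rewrite ?groupM.
  have Bsub : (WA B *m rI (g^-1)%g <= WA (B :* g^-1)%g)%MS.
    have [b Gb def_B] := rcosetsP HB.
    have Bb : repr B \in B by rewrite def_B; apply: (mem_repr b);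
      apply: rcoset_refl.
    have Grep : repr B \in G.
      by move: Bb; rewrite {2}def_B => /rcosetP[h Hh ->];
        rewrite groupM // (subsetP sHG).
    rewrite /WA -mulmxA -repr_mxM ?groupV //; apply: WrI.
      by rewrite rcosJ ?groupV.
    by rewrite mem_rcoset invgK mulgKV.
  rewrite (WE (A :* g)%g B) ?rcosJ //
    2!mulmxA (WE A (B :* g^-1)%g) ?rcosJ ?groupV //.
  rewrite (_ : (A == B :* g^-1)%g = (A :* g == B)%g).
    by case: eqP; rewrite ?mul0mx // -mulmxA -repr_mxM ?groupV //
      mulVg repr_mx1 mulmx1.
  by apply/eqP/eqP => [-> | <-]; rewrite -rcosetM ?mulVg ?mulgV rcoset1.
have cP g : g \in G -> proj_mx U V *m rI g = rI g *m proj_mx U V.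
  move=> Gg; have := proj_mx_hom (mxdirect_addsP dxUV) modU modV.
  by rewrite sumUV => /hom_mxP/(_ g Gg); rewrite !mul1mx.
move: (proj_mx U V) cP => e cP.
pose F A := \tr (rI x *m e *m E A).
have -> : \tr (rI x *m e) = \sum_(A in rcosets H G) F A.
  by rewrite -[X in \tr X]mulmx1 -sum_E mulmx_sumr linear_sum.
have actsR : [acts R, on rcosets H G | 'Rs].
  apply: subset_trans (actsRs_rcosets H G).
  by apply: subset_trans sRC (subsetIl _ _).
rewrite (sum_pgroup_fix pcharkp pR actsR) => [|g A Rg HA]; last first.
  have /setIP[Gg /cent1P cgx] := subsetP sRC g Rg.
  rewrite /F /= rcosetE E_J // !mulmxA [LHS]mxtrace_mulC !mulmxA -repr_mxM //.
  rewrite cgx repr_mxM // -(mulmxA (rI x) (rI g)) -cP // (mulmxA (rI x)).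
  by rewrite -(mulmxA _ (rI g)) -repr_mxM ?groupV // mulgV repr_mx1 mulmx1.
move=> nz; have [A] : exists A, A \in 'Fix_(rcosets H G | 'Rs)(R)%g.
  apply/existsP; apply: contraNT nz; rewrite negb_exists => /forallP fix0.
  by rewrite big1 // => A; rewrite (negbTE (fix0 A)).
case/setIP=> /rcosetsP[a Ga ->] /afixP fixA.
(* If [r] fixes the coset [H :* a], then [a * r] lies in it, so [a r a^-1] is in [H]. *)
exists a^-1%g; rewrite ?groupV //; apply/subsetP=> _ /imsetP[r Rr ->].
have := fixA r Rr; rewrite /= rcosetE => fixr.
have: (a * r \in H :* a)%g by rewrite -{}fixr mem_rcoset mulgK rcoset_refl.
by rewrite mem_rcoset conjgE invgK mulgA.
Qed.

(** * Class sums of bounded defect *)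

(** Boolean, so that it can cut out a set of classes. By Sylow conjugacy the choice of [R] is
    immaterial. *)
Definition defect_le (p : nat) (gT : finGroupType) (G P : {group gT})
    (x : gT) : bool :=
  [exists R : {group gT},
    (p.-Sylow('C_G[x]) R)%g && [exists g in G, (R :^ g)%g \subset P]].

Lemma defect_leP (p : nat) (gT : finGroupType) (G P R : {group gT}) (x : gT) :
  (R \subset 'C_G[x])%g -> p.-group R -> defect_le p G P x ->
  exists2 g, g \in G & (R :^ g)%g \subset P.
Proof.
move=> sRC pR /existsP[T /andP[sylT /exists_inP[g Gg sTP]]].
have [h /setIP[Gh _] sRT] := Sylow_Jsub sylT sRC pR.
exists (h * g)%g; first by rewrite groupM.
by apply: subset_trans sTP; rewrite conjsgM conjSg.
Qed.

Lemma defect_leI (p : nat) (gT : finGroupType) (G P R : {group gT}) (x g : gT) :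
  (p.-Sylow('C_G[x]) R)%g -> g \in G -> (R :^ g)%g \subset P ->
  defect_le p G P x.
Proof.
by move=> sylR Gg sRP; apply/existsP; exists R; rewrite sylR;
  apply/exists_inP; exists g.
Qed.

Lemma defect_leJ (p : nat) (gT : finGroupType) (G P : {group gT}) (x g : gT) :
  g \in G -> defect_le p G P (x ^ g)%g = defect_le p G P x.
Proof.
have leJ y h : h \in G -> defect_le p G P y -> defect_le p G P (y ^ h)%g.
  move=> Gh /existsP[R /andP[sylR /exists_inP[a Ga sRP]]].
  apply: (@defect_leI _ _ _ _ (R :^ h)%G _ (h^-1 * a)%g).
  - by rewrite -{1}(conjGid Gh) cent1J -conjIg pHallJ2.
  - by rewrite groupM ?groupV.
  by rewrite -conjsgM mulKVg.
move=> Gg; apply/idP/idP; last exact: leJ.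
by move/(leJ _ g^-1%g); rewrite conjgK groupV => /(_ Gg).
Qed.

(** This is the span of the p-regular class sums of defect at most [P], by [low_center_gset] and
    [low_center_sum]; conditions on coefficients are easier to check on products. *)
Definition low_center (k : fieldType) (p : nat) (gT : finGroupType)
    (G P : {group gT}) (A : 'M[k]_#|G|) : Prop :=
  in_center A /\
  forall x, x \in G -> gcoef x A != 0 -> p^'.-elt x && defect_le p G P x.

(** [gcoef_section] keeps the support p-regular. For the defect at [y], a Sylow p-subgroup [R] of
    its centralizer acts by conjugation on the terms of the convolution; a nonzero sum leaves some
    [x] centralized by [R] in the support of [A]. *)
Lemma low_center_mul (k : fieldType) (p : nat) (pcharkp : p \in [pchar k])
    (gT : finGroupType) (G P : {group gT}) (A e : 'M[k]_#|G|) :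
  in_center e -> e *m e = e -> low_center p P A -> low_center p P (A *m e).
Proof.
move=> Ze ee [ZA lowA]; split=> [|y Gy nz_y]; first exact: in_center_mul.
have [[RA class_A] [Re class_e]] := ((in_centerP A).1 ZA, (in_centerP e).1 Ze).
apply/andP; split.
  apply: contraNT nz_y => p_y; apply/eqP/(gcoef_section pcharkp) => // x Gx xy.
  apply/eqP; apply: contraNT p_y => /(lowA x Gx)/andP[p'x _].
  by apply/constt1P; rewrite -xy; apply/constt1P.
have [R sylR] := Sylow_exists p ('C_G[y])%G.
have sRC := pHall_sub sylR; have sRG := subset_trans sRC (subsetIl _ _).
move: nz_y; rewrite gcoefM //.
have actsR : [acts R, on G | 'J] by rewrite (subset_trans sRG) // astabsJ normG.
rewrite (sum_pgroup_fix pcharkp (pHall_pgroup sylR) actsR) => [nz|r x Rr Gx].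
  have [x /andP[/setIP[Gx fix_x] nz_x]] :
      exists x, (x \in 'Fix_(G | 'J)(R)) && (gcoef x A != 0).
    apply/existsP; apply: contraNT nz; rewrite negb_exists => /forallP all0.
    rewrite big1 // => x fix_x; have := all0 x; rewrite fix_x negbK => /eqP->.
    by rewrite mul0r.
  have /andP[_ le_x] := lowA x Gx nz_x.
  have sRCx : (R \subset 'C_G[x])%g.
    rewrite subsetI sRG; apply/subsetP=> r Rr; apply/cent1P.
    have /afixP/(_ r Rr) /= xr := fix_x.
    by apply: commute_sym; apply/commgP/conjg_fixP.
  have [g Gg sRP] := defect_leP sRCx (pHall_pgroup sylR) le_x.
  exact: defect_leI sylR Gg sRP.
have /setIP[Gr /cent1P cry] := subsetP sRC r Rr.
rewrite /= class_A // -(class_e (x^-1 * y)%g r) ?groupM ?groupV //.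
by rewrite conjMg conjVg (_ : y ^ r = y)%g //; apply/conjg_fixP/commgP.
Qed.

(** * Block orthogonality and the class basis *)

(** [b] splits into the orthogonal central idempotents [b c] and [b - b c], so [b c] is 0 or [b];
    likewise it is 0 or [c]. *)
Lemma block_orthogonal (k : fieldType) (gT : finGroupType) (G : {group gT})
    (b c : 'M[k]_#|G|) :
  is_block b -> is_block c -> b != c -> b *m c = 0.
Proof.
move=> [Zb bb nzb primb] [Zc cc nzc primc] b_c.
have bc : b *m c = c *m b by exact: in_centerC Zc (in_center_gring Zb).
have bcbc : b *m c *m (b *m c) = b *m c.
  by rewrite {2}bc mulmxA -(mulmxA b) cc -mulmxA -bc mulmxA bb.
have Zbc : in_center (b *m c) by exact: in_center_mul.
have ZB z w : in_center z -> in_center w -> in_center (z - w).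
  move=> Zz Zw; rewrite /in_center linearB /=.
  by rewrite addmx_sub // eqmx_opp.
have [//|bc_b] : b *m c = 0 \/ b - b *m c = 0.
  apply: primb; rewrite ?subrKC ?mulmxBr ?mulmxBl //.
  - exact: ZB.
  - by rewrite bb bcbc !mulmxA bb -mulmxA -bc mulmxA bb subrr subr0.
  by rewrite bcbc -mulmxA -bc mulmxA bb subrr.
have [//|bc_c] : b *m c = 0 \/ c - b *m c = 0.
  apply: primc; rewrite ?subrKC ?mulmxBr ?mulmxBl //.
  - exact: ZB.
  - by rewrite cc bcbc -!mulmxA cc mulmxA -bc -mulmxA cc subrr subr0.
  by rewrite bcbc -mulmxA cc subrr.
by case/eqP: b_c; rewrite (subr0_eq bc_b) -(subr0_eq bc_c).
Qed.

Lemma memv_span_map (k : fieldType) (vT : vectType k) (T : eqType) (s : seq T)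
    (F : T -> vT) (v : vT) :
  uniq s -> v \in <<[seq F x | x <- s]>>%VS ->
  exists c : T -> k, v = \sum_(x <- s) c x *: F x.
Proof.
elim: s v => [|x s IHs] v /=.
  by move=> _; rewrite span_nil memv0 => /eqP->; exists (fun=> 0);
    rewrite big_nil.
case/andP=> x_s uniq_s; rewrite span_cons => /memv_addP[_ /vlineP[a ->] [w]].
case/(IHs _ uniq_s)=> c -> ->.
exists (fun y => if y == x then a else c y); rewrite big_cons eqxx;
  congr (_ + _).
by apply: eq_big_seq => y s_y; case: eqP s_y x_s => // -> ->.
Qed.

(** Coefficients are functions on [T], so that sums can be restricted to sets of classes. As [s] has
    no repetition, changing the value at its head leaves the tail alone. *)
Lemma free_mapP (k : fieldType) (vT : vectType k) (T : eqType) (s : seq T)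
    (F : T -> vT) :
  uniq s ->
  (free [seq F x | x <- s] <->
   forall c : T -> k, \sum_(x <- s) c x *: F x = 0 ->
     {in s, forall x, c x = 0}).
Proof.
elim: s => [|x s IHs] /=; first by move=> _; rewrite nil_free.
case/andP=> x_s uniq_s; rewrite free_cons.
split=> [/andP[Fx /(IHs uniq_s).1 free_s] c | free_s].
  rewrite big_cons => sum0.
  have cx0 : c x = 0.
    apply: contraNeq Fx => nz_cx; rewrite -[F x](scalerK nz_cx) memvZ //.
    rewrite (canRL (addrK _) sum0) sub0r memvN big_seq memv_suml // => y s_y.
    by rewrite memvZ // memv_span // map_f.
  move: sum0; rewrite cx0 scale0r add0r => /free_s c0 y.
  by rewrite inE => /orP[/eqP-> | /c0].
have c_x c : \sum_(y <- s) (if y == x then -1 else c y) *: F y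
    = \sum_(y <- s) c y *: F y.
  by apply: eq_big_seq => y s_y; case: eqP s_y x_s => // -> ->.
apply/andP; split.
  apply/negP=> /(memv_span_map uniq_s)[c Fx].
  have := free_s (fun y => if y == x then -1 else c y).
  rewrite big_cons eqxx c_x scaleN1r -Fx addNr.
  by move=> /(_ erefl x (mem_head _ _))/eqP; rewrite eqxx oppr_eq0 oner_eq0.
apply/(IHs uniq_s) => c sum0 y s_y.
have := free_s (fun y => if y == x then 0 else c y).
rewrite big_cons eqxx scale0r add0r.
have -> : \sum_(j <- s) (if j == x then 0 else c j) *: F j = 0.
  by rewrite -[RHS]sum0; apply: eq_big_seq => z s_z;
    case: eqP s_z x_s => // -> ->.
move=> /(_ erefl y); rewrite inE s_y orbT => /(_ isT).
by case: eqP s_y x_s => // -> ->.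
Qed.

Lemma gcoef_gset (k : fieldType) (gT : finGroupType) (G : {group gT})
    (C : {set gT}) (y : gT) :
  C \subset G -> y \in G -> gcoef y (gset_mx k G C) = (y \in C)%:R.
Proof.
move=> sCG Gy; pose c x : k := (x \in C)%:R.
transitivity (gcoef y (\sum_(x in G) c x *: regular_repr k G x)).
  congr gcoef; rewrite /gset_mx [RHS](big_setID C) /= (setIidPr sCG).
  rewrite [X in _ = _ + X]big1 => [|x /setDP[_ /negbTE C'x]].
    by rewrite addr0; apply: eq_bigr => x Cx; rewrite /c Cx scale1r.
  by rewrite /c C'x scale0r.
by rewrite gcoef_sum.
Qed.

Definition low_classes (p : nat) (gT : finGroupType) (G P : {group gT}) :
    {set {set gT}} :=
  [set C in p_regular_classes p G | defect_le p G P (repr C)].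

Lemma p_regular_class_of (p : nat) (gT : finGroupType) (G : {group gT})
    (C : {set gT}) (x : gT) :
  C \in p_regular_classes p G -> x \in C ->
  [/\ C = (x ^: G)%g, x \in G & p^'.-elt x].
Proof.
rewrite inE => /andP[/imsetP[y Gy ->] /subsetP sC] Cx.
have := sC x Cx; rewrite inE => /andP[Gx p'x]; split=> //.
by rewrite (class_eqP Cx).
Qed.

Lemma low_classesE (p : nat) (gT : finGroupType) (G P : {group gT})
    (C : {set gT}) (x : gT) :
  C \in p_regular_classes p G -> x \in C ->
  (C \in low_classes p G P) = defect_le p G P x.
Proof.
move=> pC Cx; rewrite inE pC /=.
have [def_C _ _] := p_regular_class_of pC Cx.
have : repr C \in C by exact: mem_repr Cx.
by rewrite {2}def_C => /imsetP[g Gg ->]; exact: defect_leJ.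
Qed.

Lemma low_center_gset (k : fieldType) (p : nat) (gT : finGroupType)
    (G P : {group gT}) (C : {set gT}) :
  C \in low_classes p G P -> low_center p P (gset_mx k G C).
Proof.
move=> lowC; have pC : C \in p_regular_classes p G by case/setIdP: lowC.
have sCG : C \subset G.
  by apply/subsetP=> x /(p_regular_class_of pC)[].
split=> [|x Gx]; last first.
  rewrite gcoef_gset //; have [Cx _|] := boolP (x \in C); last by rewrite eqxx.
  by have [_ _ ->] := p_regular_class_of pC Cx; rewrite -(low_classesE _ pC Cx).
apply/in_centerP; split=> [|x g Gx Gg].
  by rewrite /gset_mx linear_sum summx_sub // => x /(subsetP sCG);
    exact: envelop_mx_id.
rewrite !gcoef_gset ?groupJ //; congr (_ : bool)%:R.
apply/idP/idP => Cx; have [-> _ _] := p_regular_class_of pC Cx.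
  by rewrite class_sym memJ_class.
exact: memJ_class.
Qed.

Lemma low_center_sum (k : fieldType) (p : nat) (gT : finGroupType)
    (G P : {group gT}) (A : 'M[k]_#|G|) :
  low_center p P A ->
  A = \sum_(C in low_classes p G P) gcoef (repr C) A *: gset_mx k G C.
Proof.
case=> ZA lowA; have [RA class_A] := (in_centerP A).1 ZA.
apply: gring_gcoef_inj => // [|x Gx].
  rewrite linear_sum summx_sub // =>
    C /(low_center_gset k)[/in_center_gring RC _].
  by rewrite linearZ scalemx_sub.
have sCG C : C \in low_classes p G P -> C \subset G.
  by case/setIdP=> pC _; apply/subsetP=> y /(p_regular_class_of pC)[].
have class_reprE C : C \in low_classes p G P -> x \in C ->
    gcoef (repr C) A = gcoef x A.
  case/setIdP=> pC _ Cx; have [def_C _ _] := p_regular_class_of pC Cx.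
  have : repr C \in C by exact: mem_repr Cx.
  by rewrite {2}def_C => /imsetP[g Gg ->]; rewrite class_A.
rewrite linear_sum /=;
  have [lowx|lowx'] := boolP ((x ^: G)%g \in low_classes p G P).
  rewrite (bigD1 (x ^: G)%g) //= big1 => [|C /andP[lowC C_x]].
    by rewrite linearZ /= gcoef_gset ?sCG //
      class_refl mulr1 addr0 class_reprE ?class_refl.
  rewrite linearZ /= gcoef_gset ?sCG //; have [Cx|] := boolP (x \in C);
    last by rewrite mulr0.
  have pC : C \in p_regular_classes p G by case/setIdP: lowC.
  by have [def_C _ _] := p_regular_class_of pC Cx; rewrite -def_C eqxx in C_x.
rewrite big1 => [|C lowC].
  apply: contraNeq lowx' => /(lowA x Gx)/andP[p'x le_x].
  have pxG : (x ^: G)%g \in p_regular_classes p G.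
    rewrite inE mem_classes //; apply/subsetP=> _ /imsetP[g Gg ->].
    by rewrite inE groupJ //= /p_elt orderJ.
  by rewrite (low_classesE _ pxG (class_refl G x)).
rewrite linearZ /= gcoef_gset ?sCG //; have [Cx|] := boolP (x \in C);
  last by rewrite mulr0.
have pC : C \in p_regular_classes p G by case/setIdP: lowC.
by have [def_C _ _] := p_regular_class_of pC Cx; rewrite -def_C lowC in lowx'.
Qed.

(** The products of the low class sums with their own blocks stay in the span of these sums and are
    free, so by dimension they span it. Multiplying the expansion of [A] by [b] keeps the classes in
    [D b]. *)
Lemma low_center_span (k : fieldType) (p : nat) (pcharkp : p \in [pchar k])
    (gT : finGroupType) (G P : {group gT}) (D : 'M[k]_#|G| -> {set {set gT}})
    (b A : 'M[k]_#|G|) :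
  is_class_decomposition p D -> is_block b -> low_center p P A -> A *m b = A ->
  exists c : {set gT} -> k,
    A = \sum_(C in low_classes p G P :&: D b) c C *: (gset_mx k G C *m b).
Proof.
move=> [_ partD basisD] blockb lowA Ab.
(* [bl] selects the block to which a class is assigned. *)
have [bl blP] : exists bl : {set gT} -> 'M[k]_#|G|,
    forall C, C \in p_regular_classes p G ->
      [/\ is_block (bl C), C \in D (bl C)
        & forall c, is_block c -> C \in D c -> bl C = c].
  suff /fin_all_exists[bl blP] : forall C, exists bC : 'M[k]_#|G|,
      C \in p_regular_classes p G ->
      [/\ is_block bC, C \in D bC
        & forall c, is_block c -> C \in D c -> bC = c] by exists bl.
  move=> C.
  have [pC|] := boolP (C \in p_regular_classes p G); last by exists 0.
  have [c [[blc DcC] uniq_c]] := partD C pC.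
  by exists c => _; split=> // d bld DdC; apply: uniq_c.
pose L := low_classes p G P.
have pL C : C \in L -> C \in p_regular_classes p G by case/setIdP.
pose F (C : {set gT}) : 'M[k]_#|G| := gset_mx k G C *m bl C.
pose X := [seq gset_mx k G C | C <- enum L].
pose Y := [seq F C | C <- enum L].
have lowX B : low_center p P B -> B \in <<X>>%VS.
  move=> /low_center_sum->; rewrite memv_suml // => C LC.
  by rewrite memvZ // memv_span // map_f ?mem_enum.
have sumD c0 (c : {set gT} -> k) : is_block c0 ->
    (\sum_(C in L) c C *: F C) *m c0 =
    \sum_(C in L :&: D c0) c C *: (gset_mx k G C *m c0).
  move=> blc0; rewrite mulmx_suml (big_setID (D c0)) /=.
  rewrite [X in _ + X]big1 => [|C /setDP[LC D'C]].
    rewrite addr0; apply: eq_bigr => C /setIP[LC DC].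
    have [_ _ /(_ c0 blc0 DC) bl_C] := blP C (pL C LC).
    by case: blc0 => _ cc _ _; rewrite -scalemxAl /F bl_C -mulmxA cc.
  have [blC DC _] := blP C (pL C LC); rewrite -scalemxAl /F -mulmxA.
  rewrite (block_orthogonal blC blc0) ?mulmx0 ?scaler0 //.
  by apply: contraNneq D'C => <-.
(* Multiplying a relation by [bl C] isolates the classes of that block, whose products are free;
   coefficients outside [L] are taken to be 0. *)
have freeY : free Y.
  apply/free_mapP => [|c]; first exact: enum_uniq.
  rewrite big_enum /= => sum0 C; rewrite mem_enum => LC.
  have [blC DC _] := blP C (pL C LC).
  have [freeD _] := basisD _ blC.
  move/(free_mapP _ (enum_uniq _)): freeD.
  move/(_ (fun B => if B \in L then c B else 0)); rewrite big_enum /=.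
  rewrite (big_setID L) /= [X in _ + X]big1 => [|B /setDP[_ /negbTE->]];
    last first.
    by rewrite scale0r.
  rewrite addr0 setIC (eq_bigr (fun B => c B *: (gset_mx k G B *m bl C)));
    last first.
    by move=> B /setIP[-> _].
  rewrite -sumD // sum0 mul0mx => /(_ erefl C); rewrite mem_enum LC.
  exact.
have sYX : (<<Y>> <= <<X>>)%VS.
  apply/span_subvP=> B /mapP[C]; rewrite mem_enum => LC {B}->.
  have [[ZC CC _ _] _ _] := blP C (pL C LC).
  by apply/lowX/(low_center_mul pcharkp) => //; exact: low_center_gset.
have eqYX : <<Y>>%VS = <<X>>%VS.
  apply/eqP; rewrite eqEdim sYX (eqP freeY).
  by apply: leq_trans (dim_span X) _; rewrite !size_map.
have : A \in <<Y>>%VS by rewrite eqYX lowX.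
case/(memv_span_map (enum_uniq _)) => c; rewrite big_enum /= => def_A.
by exists c; rewrite -sumD // -def_A.
Qed.

(** * The dual elements of modules *)

Definition p_regular_dual (k : fieldType) (p : nat) (gT : finGroupType)
    (G : {group gT}) (n : nat) (rG : mx_representation k G n) : 'M[k]_#|G| :=
  \sum_(x in G) (if p^'.-elt x then \tr (rG (x^-1)%g) else 0)
    *: regular_repr k G x.

Lemma mxtraceJ (k : fieldType) (gT : finGroupType) (G : {group gT}) (n : nat)
    (rG : mx_representation k G n) :
  {in G &, forall x g, \tr (rG (x ^ g)%g) = \tr (rG x)}.
Proof.
move=> x g Gx Gg; rewrite conjgE repr_mxM ?groupM ?groupV // mxtrace_mulC.
by rewrite -repr_mxM ?groupM ?groupV // mulgK.
Qed.

Lemma p_regular_dual_low (k : fieldType) (p : nat) (pcharkp : p \in [pchar k])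
    (gT : finGroupType) (G V : {group gT}) (n : nat)
    (rG : mx_representation k G n) :
  V \subset G -> relatively_projective V rG ->
  low_center p V (p_regular_dual p rG).
Proof.
move=> sVG projV; split=> [|x Gx].
  apply: in_center_class_fun => x g Gx Gg.
  by rewrite /p_elt orderJ -conjVg mxtraceJ ?groupV.
rewrite gcoef_sum //; case: ifP => [_ nz_x|_]; last by rewrite eqxx.
have [R sylR] := Sylow_exists p ('C_G[x])%G.
have sRC : (R \subset 'C_G[x^-1])%g.
  rewrite (_ : 'C[x^-1] = 'C[x])%g ?(pHall_sub sylR) //.
  by apply/setP=> y; apply/cent1P/cent1P => /commuteV; rewrite ?invgK.
have Gx' : (x^-1)%g \in G by rewrite groupV.
have [g Gg sRV] :=
  relatively_projective_trace pcharkp sVG projV Gx' sRC (pHall_pgroup sylR) nz_x.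
exact: defect_leI sylR Gg sRV.
Qed.

(** For the dual [z] over all of [G], the coefficient of [y] in [b z] is the trace of the inverse of
    [y] times [b], and [b] acts as 1. [gcoef_section] transfers this to the p-regular part [z']. *)
Lemma p_regular_dual_block (k : fieldType) (p : nat)
    (pcharkp : p \in [pchar k]) (gT : finGroupType) (G : {group gT})
    (b : 'M[k]_#|G|) (n : nat) (rG : mx_representation k G n) :
  in_center b -> b *m b = b -> in_block b rG ->
  p_regular_dual p rG *m b = p_regular_dual p rG.
Proof.
move=> Zb bb rb; have Rb := in_center_gring Zb; set z' := p_regular_dual p rG.
pose z := \sum_(x in G) \tr (rG (x^-1)%g) *: regular_repr k G x.
have Zz' : in_center z'.
  apply: in_center_class_fun => x g Gx Gg.
  by rewrite /p_elt orderJ -conjVg mxtraceJ ?groupV.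
have Zz : in_center z.
  by apply: in_center_class_fun => x g Gx Gg; rewrite -conjVg mxtraceJ ?groupV.
have [Rz Rz'] := (in_center_gring Zz, in_center_gring Zz').
have zb y : y \in G -> gcoef y (z *m b) = gcoef y z.
  move=> Gy; have Gy' : (y^-1)%g \in G by rewrite groupV.
  rewrite -(in_centerC Zz Rb) gcoefM // gcoef_sum //.
  rewrite -[rG (y^-1)%g]mulmx1 -rb [in RHS](gring_sum_gcoef Rb).
  rewrite linear_sum mulmx_sumr linear_sum; apply: eq_bigr => x Gx.
  rewrite /z gcoef_sum ?groupM ?groupV // linearZ /= gring_opG //.
  by rewrite -scalemxAr linearZ /= -repr_mxM // invMg invgK.
apply: gring_gcoef_inj => // [|y Gy]; first exact: envelop_mxM.
have [p'y | p_y] := boolP (p^'.-elt y).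
  transitivity (gcoef y (z *m b)); last by rewrite zb // !gcoef_sum // p'y.
  (* Elements with the same p-part as [y] are p-regular, and there [z] and [z'] agree. *)
  apply/eqP; rewrite -subr_eq0 -linearB -mulmxBl; apply/eqP.
  apply: (gcoef_section pcharkp) => // [|x Gx xy].
    by rewrite /in_center linearB /= addmx_sub // eqmx_opp.
  rewrite linearB /= !gcoef_sum // ifT ?subrr //.
  by apply/constt1P; rewrite xy; apply/constt1P.
rewrite [RHS]gcoef_sum // (negbTE p_y).
apply: (gcoef_section pcharkp) => // x Gx xy; rewrite gcoef_sum // ifN //.
by apply: contra p_y => /constt1P x1; apply/constt1P; rewrite -xy.
Qed.

(** * From a nonzero determinant to the permutation *)

Lemma det_neq0_perm (R : comNzRingType) (n : nat) (A : 'M[R]_n) :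
  \det A != 0 -> exists s : {perm 'I_n}, forall i, A i (s i) != 0.
Proof.
move=> nz; have /existsP[s /forallP As] : [exists s :
  {perm 'I_n}, forall i, A i (s i) != 0].
  apply: contraNT nz; rewrite negb_exists => /forallP noS.
  apply/eqP/big1 => s _; have := noS s; rewrite negb_forall => /existsP[i].
  by rewrite negbK => /eqP Ai0; rewrite (bigD1 i) //= Ai0 mul0r mulr0.
by exists s.
Qed.

Theorem proposition1p1 (k : closedFieldType) (p : nat) (pcharkp : p \in [pchar k])
  (gT : finGroupType) (G : {group gT})
  (b : 'M[k]_#|G|) (blockb : is_block b)
  (* the decomposition of the p-regular classes *)
  (D : 'M[k]_#|G| -> {set {set gT}}) (decD : is_class_decomposition p D)
  (l : nat)
  (* Cl_{p'}(b) = {C_i} and the lower defect groups Q_i *)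
  (C : 'I_l -> {set gT}) (injC : injective C) (imC : [set C i | i : 'I_l] = D b)
  (Q : 'I_l -> {group gT}) (defectQ : forall i, is_defect_group p G (C i) (Q i))
  (* the simple modules S_i and their vertices V_i *)
  (n : 'I_l -> nat) (S : forall i, mx_representation k G (n i))
  (repsS : simple_reps b S)
  (V : 'I_l -> {group gT}) (vertexV : forall i, is_vertex (V i) (S i)) :
  (exists sigma : {perm 'I_l}, forall i, conj_subset G (Q i) (V (sigma i))) /\
  (\prod_(i < l) #|Q i| <= \prod_(i < l) #|V i|)%N.
Proof.
suff [sigma QV] : exists sigma : {perm 'I_l},
    forall i, conj_subset G (Q i) (V (sigma i)).
  split; first by exists sigma.
  (* The permutation reorders the second product, and conjugation preserves group orders. *)
  rewrite [leqRHS](reindex_inj (@perm_inj _ sigma)) /=.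
  apply: leq_prod => i _; have [g _ sQV] := QV i.
  by rewrite -(cardJg (Q i) g) subset_leq_card.
have [irrS simS _] := repsS; have [Zb bb _ _] := blockb.
pose z j := p_regular_dual p (S j).
have lowz j : low_center p (V j) (z j).
  by have [sVG projV _] := vertexV j; exact: p_regular_dual_low.
have [c zE] : exists c : 'I_l -> {set gT} -> k, forall j,
    z j = \sum_(B in low_classes p G (V j) :&: D b) c j B *:
      (gset_mx k G B *m b).
  suff /fin_all_exists[c cP] : forall j, exists c : {set gT} -> k,
      z j = \sum_(B in low_classes p G (V j) :&: D b)
        c B *: (gset_mx k G B *m b) by exists c.
  move=> j.
  apply: (low_center_span pcharkp decD) => //.
  by apply: p_regular_dual_block => //; have [] := irrS j.
(* Rows are modules and columns are classes. With 0 outside the low classes of [V j], a nonzero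
   entry certifies the defect bound. *)
pose A := \matrix_(j, i) (if C i \in low_classes p G (V j) then c j (C i) else 0).
have {}zE j : z j = \sum_i A j i *: (gset_mx k G (C i) *m b).
  rewrite zE setIC -imC.
  rewrite [LHS](_ : _ = \sum_(B in [set C i | i : 'I_l])
      (if B \in low_classes p G (V j) then c j B else 0) *:
        (gset_mx k G B *m b)).
    rewrite big_imset /=; last by move=> i1 i2 _ _ /injC.
    by apply: eq_bigr => i _; rewrite mxE.
  rewrite [RHS](big_setID (low_classes p G (V j))) /= [X in _ = _ + X]big1.
    by rewrite addr0; apply: eq_bigr => B /setIP[_ ->].
  by move=> B /setDP[_ /negbTE->]; rewrite scale0r.
have detA : \det A != 0.
  (* A row vector killed by [A] is a linear relation between the [z j], hence between the traces on
     p-regular elements. *)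
  apply/det0P=> -[v nz_v vA0].
  have sum0 : \sum_j v 0 j *: z j = 0.
    under eq_bigr => j _ do rewrite zE scaler_sumr.
    rewrite exchange_big big1 // => i _ /=.
    under eq_bigr => j _ do rewrite scalerA.
    rewrite -scaler_suml; have -> : \sum_j v 0 j * A j i = (v *m A) 0 i.
      by rewrite [RHS]mxE.
    by rewrite vA0 mxE scale0r.
  case/eqP: nz_v; apply/rowP=> j; rewrite mxE.
  apply: (p_regular_traces_free pcharkp (a := fun j => v 0 j)) (simS) _ j.
    by move=> i; have [] := irrS i.
  (* The coefficient at the inverse of [x] recovers the trace of [x]. *)
  move=> x Gx p'x; have := congr1 (gcoef (x^-1)%g) sum0.
  rewrite linear0 linear_sum => sum_x0; rewrite -[RHS]sum_x0.
  apply: eq_bigr => j _.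
  by rewrite linearZ /= gcoef_sum ?groupV // p_eltV p'x invgK.
(* [s] goes from modules to classes, the wanted permutation from classes to modules. *)
have [s As] := det_neq0_perm detA; exists (s^-1)%g => i.
have := As (s^-1 i)%g; rewrite permKV mxE; case: ifP => [lowC _|];
  last by rewrite eqxx.
have [x Cx sylQ] := defectQ i.
have pC : C i \in p_regular_classes p G by case/setIdP: lowC.
move: lowC; rewrite (low_classesE _ pC Cx) => lex.
exact: defect_leP (pHall_sub sylQ) (pHall_pgroup sylQ) lex.
Qed.
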